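(* Let $n$ be an almost-prime number, let $p$ be a prime divisor of $n$, and let $s=q^{\nu}$ be a divisor of $p-1$, where $q$ is an odd prime and $\nu\ge 1$. Let $g$ be a generator of the cyclic group $(\mathbb{Z}/s\mathbb{Z})^{*}$, and for each integer $r$ let $\omega_r$ denote the number of distinct prime divisors of $n$ that are congruent to $r$ modulo $s$. Let $\zeta$ be a primitive $\varphi(s)$-th root of unity, $K=\mathbb{Q}(\zeta)$, and $\mathcal{O}_K=\mathbb{Z}[\zeta]$ its ring of integers. Define $$f(x)=\prod_{l=1}^{\varphi(s)}\left(1+x^l\right)^{\omega_{g^l}}.$$ Then for every $\varphi(s)$-th root of unity $\eta$ we have $f(\eta)\equiv d(n)\pmod{p}$ in $\mathcal{O}_K$, i.e. $f(\eta)-d(n)\in p\mathcal{O}_K$.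
   Context: For a positive integer $n$ with positive divisors $1=d_1<d_2<\dots<d_k=n$, define the polynomial $T_n(x)=x^{d_1}+x^{d_2}+\dots+x^{d_k}-kx$. A positive integer $n$ is called weakly almost-prime if $n\mid T_n(x)$ for all integers $x$; it is called almost-prime if it is weakly almost-prime and square-free. $d(n)$ denotes the number of positive divisors of $n$, and $\varphi$ is Euler's totient function. *)

(* Defs.v *)
From HB Require Import structures.
From mathcomp Require Import all_boot all_order all_fingroup all_algebra.
From mathcomp Require Import all_solvable all_field.

Set Implicit Arguments.
Unset Strict Implicit.
Unset Printing Implicit Defensive.

Import GRing.Theory.
Local Open Scope ring_scope.

Definition num_divisors (n : nat) : nat := size (divisors n).

Definition T_poly (n : nat) : {poly int} :=
  \sum_(d <- divisors n) 'X^d - 'X *+ num_divisors n.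

Definition weakly_almost_prime (n : nat) : Prop :=
  (0 < n)%N /\ forall x : int, (n%:Z %| (T_poly n).[x])%Z.

Definition square_free (n : nat) : Prop :=
  forall m : nat, (m ^ 2 %| n)%N -> m = 1%N.

Definition almost_prime (n : nat) : Prop :=
  weakly_almost_prime n /\ square_free n.

(* [primes n] is duplicate-free, so this counts distinct prime divisors. *)
Definition omega (n s : nat) (r : int) : nat :=
  count (fun p : nat => (p%:Z == r %[mod s%:Z])%Z) (primes n).

(* The least nonnegative integer in the residue class [u]; [omega n s r]
   depends only on [r] modulo [s], so any representative would do. *)
Definition unit_repr (s : nat) (u : {unit 'Z_s}) : int :=
  (nat_of_ord (FinRing.uval u))%:Z.

Definition f_poly (n s : nat) (g : {unit 'Z_s}) : {poly int} :=
  \prod_(1 <= l < (totient s).+1)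
     (1 + 'X^l) ^+ omega n s (unit_repr (g ^+ l)%g).

Definition ring_of_integers (K : fieldExtType rat) (z : K) : Prop :=
  integralOver (intr : int -> K) z.

Definition Z_adjoin (K : fieldExtType rat) (zeta z : K) : Prop :=
  exists h : {poly int}, z = (map_poly intr h).[zeta].

(* Congruence modulo [p O_K].  The quotient is required to lie both in the
   ring of integers and in Z[zeta]: for K = Q(zeta), zeta a root of unity, the
   two rings coincide, and stating both avoids relying on that fact. *)
Definition congr_mod_OK (K : fieldExtType rat) (zeta : K) (p : nat) (a b : K) :
    Prop :=
  exists z : K, [/\ ring_of_integers z, Z_adjoin zeta z & a - b = p%:R * z].

(* Main.v *)
Require Import Defs.
From HB Require Import structures.
From mathcomp Require Import all_boot all_order all_fingroup all_algebra.
From mathcomp Require Import all_solvable all_field.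

(** Modulo [p], the polynomial [T_n] with exponents reduced modulo [p - 1]
    vanishes on all nonzero residues although its degree is less than [p - 1],
    so it is zero: the number of divisors [d] of [n] in a residue class modulo
    [p - 1] is divisible by [p], except for the class of 1 where it is congruent
    to [d(n)].  If [chi] is the character modulo [s] with [chi(g) = eta], then
    for square-free [n] one has [f(eta) = \prod_(r | n prime) (1 + chi(r)) =
    \sum_(d | n) chi(d)].  As [s] divides [p - 1], [chi(d)] depends only on
    [d] modulo [p - 1], so only the class of 1 contributes modulo [p]. *)

Import GRing.Theory.
Local Open Scope ring_scope.

(** * Divisor sums over square-free numbers *)

Lemma perm_divisors_mul_prime (p m : nat) :
  prime p -> (0 < m)%N -> ~~ (p %| m)%N ->
  perm_eq (divisors (p * m)) (divisors m ++ [seq (p * d)%N | d <- divisors m]).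
Proof.
move=> pp m0 pNm; have p0 := prime_gt0 pp.
apply: uniq_perm; first exact: divisors_uniq.
  rewrite cat_uniq divisors_uniq map_inj_uniq ?divisors_uniq ?andbT /=.
    apply/hasPn => _ /mapP[d dm ->]; rewrite /= -dvdn_divisors //.
    by apply: contra pNm; apply: dvdn_trans; exact: dvdn_mulr.
  by move=> a b /eqP; rewrite eqn_pmul2l // => /eqP.
move=> d; rewrite mem_cat -!dvdn_divisors ?muln_gt0 ?p0 //.
apply/idP/orP => [dpm|[dm|/mapP[e em ->]]]; last 2 first.
- exact: dvdn_mull.
- by rewrite dvdn_pmul2l // dvdn_divisors.
have [/dvdnP[e de]|pNd] := boolP (p %| d)%N.
  right; apply/mapP; exists e; last by rewrite de mulnC.
  by rewrite -dvdn_divisors // -(dvdn_pmul2l p0) mulnC -de.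
by left; rewrite -(@Gauss_dvdr _ p) // coprime_sym prime_coprime.
Qed.

(** Induction on [rs]: a new prime [p] doubles the set of divisors, and multiplicativity turns the
    new half into [chi p] times the old sum, whence the factor [1 + chi p]. *)
Lemma sum_divisors_prod_primes (R : comPzRingType) (chi : nat -> R)
    (rs : seq nat) :
  chi 1%N = 1 -> (forall d e, chi (d * e)%N = chi d * chi e) ->
  uniq rs -> all prime rs ->
  \sum_(d <- divisors (\prod_(r <- rs) r)%N) chi d =
    \prod_(r <- rs) (1 + chi r).
Proof.
move=> chi1 chiM; elim: rs => [|p rs IH] /=.
  by rewrite !big_nil big_seq1.
case/andP=> pNrs urs /andP[pp prs].
have m0 : (0 < \prod_(r <- rs) r)%N.
  by rewrite big_seq; apply: prodn_cond_gt0 => r /(allP prs) /prime_gt0.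
have pNm : ~~ (p %| \prod_(r <- rs) r)%N.
  rewrite Euclid_dvd_prod // big_has; apply: contra pNrs => /hasP[r rin].
  by rewrite /= dvdn_prime2 ?(allP prs r rin) // => /eqP->.
rewrite !big_cons (perm_big _ (perm_divisors_mul_prime p _ pp m0 pNm)) big_cat.
rewrite big_map /= (eq_bigr _ (fun d _ => chiM p d)) -big_distrr /= IH //.
by rewrite mulrDl mul1r.
Qed.

Lemma square_free_prod_primes (n : nat) :
  (0 < n)%N -> square_free n -> n = (\prod_(r <- primes n) r)%N.
Proof.
move=> n0 sqf; rewrite [LHS]prod_prime_decomp // prime_decompE big_map.
apply: eq_big_seq => r rn /=; suff -> : logn r n = 1%N by [].
move: rn; rewrite mem_primes => /and3P[pr _ rn]; apply/eqP; rewrite eqn_leq.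
rewrite logn_gt0 mem_primes pr n0 rn !andbT leqNgt.
apply/negP => r2; have r2n : (r ^ 2 %| n)%N by rewrite pfactor_dvdn.
by rewrite (sqf r r2n) in pr.
Qed.

(** * Residues of the divisors modulo [p.-1] *)

Lemma Fp_divisor_exponents (n p : nat) :
  weakly_almost_prime n -> prime p -> (p %| n)%N -> (1 < p.-1)%N ->
  \sum_(d <- divisors n) 'X^(d %% p.-1) = 'X *+ num_divisors n :> {poly 'F_p}.
Proof.
move=> [n0 hT] pp pn p1; have cardF := card_Fp pp.
apply/eqP; rewrite -subr_eq0; set P := (X in X == 0); apply/negPn/negP => P0.
(* Reduced exponents are below [p.-1], and ['X] has size 2, so the degree is less than the number
   [p.-1] of nonzero residues. *)
have szP : (size P <= p.-1)%N.
  apply: leq_trans (size_polyD _ _) _; rewrite geq_max size_polyN.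
  apply/andP; split.
    apply: leq_trans (size_sum _ _ _) _; apply/bigmax_leqP_seq => d _ _.
    by rewrite size_polyXn ltn_mod; apply: ltnW.
  rewrite -scaler_nat; apply: leq_trans (size_scale_leq _ _) _.
  by rewrite size_polyX.
have := max_poly_roots (rs := enum [pred x : 'F_p | x != 0]) P0.
rewrite enum_uniq -cardE.
have -> : #|[pred x : 'F_p | x != 0]| = p.-1.
  have := cardC1 (0 : 'F_p); rewrite cardF => <-.
  by apply: eq_card => x; rewrite !inE.
rewrite ltnNge szP => /(_ _ isT) H; apply: (elimF idP erefl (H _)).
apply/allP => x; rewrite mem_enum inE => x0.
(* Fermat: reducing an exponent modulo [p.-1] does not change the power of a nonzero [x]. *)
have xp : x ^+ p.-1 = 1.
  apply: (mulfI x0); rewrite -exprS prednK ?prime_gt0 // mulr1.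
  by have := expf_card x; rewrite cardF.
have xn : x = (x : nat)%:Z%:~R by rewrite -pmulrn natr_Zp.
have := dvdz_trans (pn : (p%:Z %| n%:Z)%Z) (hT (x : nat)%:Z).
rewrite (dvdz_pcharf (pchar_Fp pp)) /T_poly !hornerE hornerMn hornerX.
rewrite horner_sum rmorphB rmorphMn rmorph_sum /= -xn.
rewrite rootE /P !hornerE hornerMn hornerX horner_sum.
congr (_ - _ == 0); apply: eq_bigr => d _; rewrite !hornerXn rmorphXn /= -xn.
by rewrite expr_mod.
Qed.

(** Grouping the divisors by residue [b], every class but that of 1 has size divisible by [p].
    Nothing is asked of [c], and [R] is arbitrary, so that the quotient [h] can be found in
    [{poly int}]. *)
Lemma sum_divisors_modn (R : pzRingType) (c : nat -> R) (n p : nat) :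
  weakly_almost_prime n -> prime p -> (p %| n)%N -> (1 < p.-1)%N ->
  exists h : R, \sum_(d <- divisors n) c (d %% p.-1)%N =
    c 1%N *+ num_divisors n + h *+ p.
Proof.
move=> hn pp pn p1; have hP := Fp_divisor_exponents _ _ hn pp pn p1.
pose N b := (\sum_(d <- divisors n) (b == d %% p.-1))%N.
(* Compare the coefficients of ['X^b]. A sigma type, rather than a mere existence, lets the
   quotients for all [b] be combined into the witness [h]. *)
have hN b : {z : int | (N b)%:Z = ((b == 1) * num_divisors n)%N%:Z + z * p%:Z}.
  have : (p%:Z %| (N b)%:Z - ((b == 1) * num_divisors n)%N%:Z)%Z.
    rewrite (dvdz_pcharf (pchar_Fp pp)) rmorphB /= -!pmulrn subr_eq0.
    have := congr1 (fun P : {poly 'F_p} => P`_b) hP.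
    rewrite coef_sum coefMn coefX mulrnA => <-.
    by rewrite natr_sum; apply/eqP/eq_bigr => d _; rewrite coefXn.
  by case/dvdzP/sig_eqW => z hz; exists z; rewrite -hz addrC subrK.
have -> : \sum_(d <- divisors n) c (d %% p.-1)%N =
    \sum_(b < p.-1) c b *~ (N b)%:Z.
  transitivity (\sum_(d <- divisors n) \sum_(b < p.-1)
      c b *+ (b == d %% p.-1 :> nat)%N).
    apply: eq_bigr => d _.
    have dp : (d %% p.-1 < p.-1)%N by rewrite ltn_mod ltnW.
    rewrite (bigD1 (Ordinal dp)) //= eqxx big1 ?addr0 // => b.
    by rewrite -val_eqE /= => /negPf->.
  by rewrite exchange_big; apply: eq_bigr => b _; rewrite -pmulrn -sumrMnr.
exists (\sum_(b < p.-1) c b *~ sval (hN b)).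
rewrite -sumrMnl.
under eq_bigr => b _ do
  rewrite (svalP (hN b)) mulrzDr mulrzA -!pmulrn mulrnA.
(* The proof [p1] of [1 < p.-1] makes 1 an index of the sum, the only one with a main term. *)
rewrite big_split /= (bigD1 (Ordinal p1)) //= mulr1n big1 ?addr0 // => b.
by rewrite -val_eqE /= => /negPf->; rewrite mul0rn.
Qed.

(** * Discrete logarithms and the character modulo [s] *)

(** The range is a complete residue system modulo the order of [g], so exactly one index passes the
    filter. A general law [op] covers both the sum in [dchar] and the product in [prod_dlog]. *)
Lemma big_dlog (R : Type) (idx : R) (op : Monoid.com_law idx) (s l0 : nat)
    (g : {unit 'Z_s}) (x : 'Z_s) (F : nat -> R) :
  (1 < s)%N -> generator (units_Zp s) g ->
  (forall l, F (l %% totient s)%N = F l) -> x = FinRing.uval (g ^+ l0)%g ->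
  \big[op/idx]_(1 <= l < (totient s).+1 | x == FinRing.uval (g ^+ l)%g) F l =
    F l0.
Proof.
move=> s1 hg Fmod ->; have s0 := ltnW s1.
have og : #[g]%g = totient s.
  by move: hg; rewrite /generator => /eqP hg; rewrite -card_units_Zp // hg.
have t0 : (0 < totient s)%N by rewrite totient_gt0.
under eq_bigl => l do
  rewrite (inj_eq val_inj) eq_expg_mod_order og.
(* The last index [l = totient s] plays the role of [l = 0]. *)
rewrite big_mkcond big_nat_recr //= modnn -(Fmod (totient s)) modnn.
have -> : (l0 %% totient s == 0)%N = (l0 %% totient s == 0 %% totient s)%N.
  by rewrite mod0n.
rewrite Monoid.mulmC -(big_ltn (F := fun l =>
  if l0 %% totient s == l %% totient s then F l else idx)%N) //.
have lt0 : (l0 %% totient s < totient s)%N by rewrite ltn_mod.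
rewrite big_mkord (bigD1 (Ordinal lt0)) //= modn_mod eqxx Fmod.
rewrite big1 ?Monoid.mulm1 // => l; rewrite -val_eqE /= => lN.
by rewrite [(l %% _)%N]modn_small // eq_sym (negPf lN).
Qed.

Lemma generator_unitP (s d : nat) (g : {unit 'Z_s}) :
  (1 < s)%N -> generator (units_Zp s) g -> coprime s d ->
  exists l, d%:R = FinRing.uval (g ^+ l)%g.
Proof.
move=> s1 /eqP hg sd.
have ud : (d%:R : 'Z_s) \is a GRing.unit by rewrite unitZpE.
have : FinRing.unit 'Z_s ud \in <[g]>%g by rewrite -hg inE.
by case/cycleP => l /(congr1 val) /= dl; exists l.
Qed.

Lemma coprime_generator (s d l : nat) (g : {unit 'Z_s}) :
  (1 < s)%N -> d%:R = FinRing.uval (g ^+ l)%g -> coprime s d.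
Proof. by move=> s1 dl; rewrite -unitZpE // dl; exact: valP. Qed.

(* The Dirichlet character modulo [s] sending the generator [g] to [eta]. *)
Definition dchar (R : comPzRingType) (s : nat) (g : {unit 'Z_s}) (eta : R)
    (d : nat) : R :=
  \sum_(1 <= l < (totient s).+1 | d%:R == FinRing.uval (g ^+ l)%g) eta ^+ l.

Section Dchar.
Context (R : comNzRingType) (s : nat) (g : {unit 'Z_s}) (eta : R).
Hypotheses (s1 : (1 < s)%N) (hg : generator (units_Zp s) g).
Hypothesis heta : eta ^+ totient s = 1.

Lemma dchar_exp (d l : nat) :
  d%:R = FinRing.uval (g ^+ l)%g -> dchar R s g eta d = eta ^+ l.
Proof. by move=> dl; apply: big_dlog => // k; rewrite expr_mod. Qed.

Lemma dchar_ncoprime (d : nat) : ~~ coprime s d -> dchar R s g eta d = 0.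
Proof.
move=> sd; apply: big1 => l /eqP dl.
by rewrite (coprime_generator _ _ _ _ s1 dl) in sd.
Qed.

Lemma dchar1 : dchar R s g eta 1 = 1.
Proof. by rewrite (dchar_exp 1 0). Qed.

Lemma dcharM (d e : nat) :
  dchar R s g eta (d * e) = dchar R s g eta d * dchar R s g eta e.
Proof.
have [sd|sd] := boolP (coprime s d); last first.
  by rewrite (dchar_ncoprime _ sd) mul0r dchar_ncoprime // coprimeMr (negPf sd).
have [se|se] := boolP (coprime s e); last first.
  by rewrite (dchar_ncoprime _ se) mulr0 dchar_ncoprime // coprimeMr (negPf se)
       andbF.
have [i di] := generator_unitP _ _ _ s1 hg sd.
have [j ej] := generator_unitP _ _ _ s1 hg se.
rewrite (dchar_exp _ _ di) (dchar_exp _ _ ej) -exprD; apply: dchar_exp.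
by rewrite natrM di ej expgD.
Qed.

Lemma dchar_mod (m d : nat) :
  (s %| m)%N -> dchar R s g eta (d %% m) = dchar R s g eta d.
Proof.
move=> sm; rewrite /dchar; suff -> : (d %% m)%:R = d%:R :> 'Z_s by [].
by apply: val_inj; rewrite /= !val_Zp_nat // modn_dvdm.
Qed.

(** For [d] coprime to [s] one factor survives; otherwise the product is empty and the character
    vanishes, so both sides are 1. *)
Lemma prod_dlog (d : nat) :
  \prod_(1 <= l < (totient s).+1 | d%:R == FinRing.uval (g ^+ l)%g)
    (1 + eta ^+ l) = 1 + dchar R s g eta d.
Proof.
have [sd|sd] := boolP (coprime s d); last first.
  rewrite dchar_ncoprime // addr0; apply: big1 => l /eqP dl.
  by rewrite (coprime_generator _ _ _ _ s1 dl) in sd.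
have [i di] := generator_unitP _ _ _ s1 hg sd.
rewrite (dchar_exp _ _ di).
apply: (big_dlog _ _ _ _ _ _ _ (fun l => 1 + eta ^+ l)) => // k.
by rewrite expr_mod.
Qed.

(** As [omega] counts the primes in the class of [g ^+ l], each power is a product over [primes n];
    exchanging the products leaves [prod_dlog] at each prime. *)
Lemma horner_f_poly (n : nat) :
  (map_poly intr (f_poly n g)).[eta] =
    \prod_(r <- primes n) (1 + dchar R s g eta r).
Proof.
under [RHS]eq_bigr => r _ do rewrite -prod_dlog big_mkcond.
rewrite exchange_big rmorph_prod horner_prod; apply: eq_bigr => l _.
rewrite -big_mkcond rmorphXn horner_exp rmorphD rmorph1 /= map_polyXn hornerD.
rewrite hornerC hornerXn big_const_seq iter_mulr_1; congr (_ ^+ _).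
apply: eq_count => r.
rewrite /unit_repr !modz_nat eqz_nat -val_eqE /= val_Zp_nat //.
(* The carrier of ['Z_s] has [s] elements only because [1 < s]. *)
have ls : (FinRing.uval (g ^+ l)%g < s)%N.
  by rewrite -[X in (_ < X)%N](Zp_cast s1) ltn_ord.
by rewrite (modn_small ls).
Qed.
End Dchar.

(** * Evaluation at [zeta] and integrality *)

(** Lifts the character values to integer polynomials. There ['X^i] need not be a root of unity, but
    the defining sum of [dchar] still makes sense. *)
Lemma dchar_horner (K : comNzRingType) (s : nat) (g : {unit 'Z_s}) (i d : nat)
    (zeta : K) :
  dchar K s g (zeta ^+ i) d =
    (map_poly intr (dchar {poly int} s g 'X^i d)).[zeta].
Proof.
rewrite /dchar rmorph_sum horner_sum; apply: eq_bigr => l _.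
by rewrite -!exprM /= map_polyXn hornerXn.
Qed.

Lemma Z_adjoin_integral (K : fieldExtType rat) (zeta z : K) :
  ring_of_integers zeta -> Z_adjoin zeta z -> ring_of_integers z.
Proof.
move=> hzeta [h ->]; apply: integral_horner => //; apply/integral_poly => i.
by rewrite coef_map; apply: integral_id.
Qed.

Lemma unity_root_integral (K : fieldExtType rat) (m : nat) (zeta : K) :
  (0 < m)%N -> zeta ^+ m = 1 -> ring_of_integers zeta.
Proof.
move=> m0 hzeta.
exists ('X^m - 1); first exact: monicXnsubC.
rewrite rmorphB rmorph1 /= map_polyXn rootE !hornerE.
by rewrite hzeta subrr.
Qed.

Theorem theorem1p7 (n p q nu s : nat) (g : {unit 'Z_s})
    (K : fieldExtType rat) (zeta : K)
    (hn : almost_prime n)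
    (hp : prime p) (hpn : (p %| n)%N)
    (hq : prime q) (hqodd : odd q) (hnu : (1 <= nu)%N)
    (hs : s = (q ^ nu)%N) (hsp : (s %| p - 1)%N)
    (hg : generator (units_Zp s) g)
    (hzeta : (totient s).-primitive_root zeta)
    (hK : <<1; zeta>>%VS = {:K}%VS)
    (eta : K) (heta : eta ^+ totient s = 1) :
  congr_mod_OK zeta p (map_poly intr (f_poly n g)).[eta] (num_divisors n)%:R.
Proof.
have [hw sqf] := hn; have [n0 _] := hw.
have s1 : (1 < s)%N by rewrite hs -(exp1n nu) ltn_exp2r ?prime_gt1.
rewrite subn1 in hsp.
have p1 : (1 < p.-1)%N.
  by apply: leq_trans s1 (dvdn_leq _ hsp); rewrite -subn1 subn_gt0 prime_gt1.
have [i etaE] := prim_rootP hzeta heta.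
have fE : (map_poly intr (f_poly n g)).[eta] =
    \sum_(d <- divisors n) dchar K s g eta d.
  rewrite horner_f_poly // [in RHS](square_free_prod_primes _ n0 sqf).
  rewrite sum_divisors_prod_primes ?primes_uniq ?all_prime_primes //.
  - exact: dchar1.
  - exact: dcharM.
(* Over [{poly int}] the quotient [h] is an integer polynomial, so its value at [zeta] lies in
   [Z[zeta]]. *)
have [h hE] := sum_divisors_modn _ (dchar {poly int} s g 'X^i) n p hw hp hpn p1.
have zZ : Z_adjoin zeta (map_poly intr h).[zeta] by exists h.
exists (map_poly intr h).[zeta]; split=> //.
  apply: Z_adjoin_integral zZ.
  exact: unity_root_integral (prim_order_gt0 hzeta) (prim_expr_order hzeta).
have := congr1 (fun P : {poly int} => (map_poly intr P : {poly K}).[zeta]) hE.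
rewrite rmorph_sum rmorphD !rmorphMn horner_sum hornerD !hornerMn.
(* Since [s] divides [p.-1], the character ignores the reduction of [d] modulo [p.-1]. *)
under eq_bigr => d _ do rewrite -dchar_horner -etaE dchar_mod //.
rewrite -fE => ->.
by rewrite -dchar_horner -etaE dchar1 // addrC addKr mulr_natl.
Qed.
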